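(* Fix an integer $t\ge2$. (1) (Core generation.) For every admissible parameter $(m,k)$, with $n=tk$, the core edge sequence (unit edges of direction angles $2\pi s_j/n$, $j=0,\dots,k-1$) is reconstructed exactly from the leaves of the decomposition tree of $(m,k)$ — each leaf being a single unit edge of angle $0$ — by iterated fan-twist splicing of cores along the tree. (2) (Decoration attachment.) For every closed template pair $(\ell,u)$, mediant splicing lifts: for every pair of admissible parameters $(m_1,k_1),(m_2,k_2)$ with $m_2k_1-m_1k_2=1$ and mediant $(m,k)=(m_1+m_2,k_1+k_2)$, if the core edges occurring in the template are rotated by the fan-twist amounts and placed in order (core edges of $(m_1,k_1)$ first, then those of $(m_2,k_2)$), while the decoration edges are left unchanged at the same template positions, then the resulting spliced part coincides, edge by edge and vertex by vertex in both the $\ell$-path and the $u$-path, with the part of $(m,k)$ given by the same template pair; and this part is closed, i.e. its $\ell$-path and $u$-path have the same endpoint. Every one of the seven template pairs listed in the context is a closed template pair with decorations only $\mathsf{Z}$ and $\mathsf{K}$; in each of these, $\ell$ and $u$ even use one and the same multiset of directions. Consequently every prototile part of each of the seven template pairs is obtained as: one unit edge $\to$ (iterated fan-twist splicing) $\to$ core $\to$ (attachment of finitely many decoration edges, with, for templates whose core run starts at $\mathsf{C}_1$, the core edge $\mathsf{C}_0$ omitted); and mediant splicing lifts to every closed template pair, in particular to all seven. The generation of the original prototile (lower path $=$ core followed by the terminal edge) from a single unit edge is the special case of the original template, whose lower word has the single decoration $\mathsf{K}$.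
   Context: An admissible parameter is a pair of integers $(m,k)$ that either satisfies $0<m<k$ and $\gcd(m,k)=1$, or is one of the two formal seeds $(0,1)$, $(1,1)$. For admissible $(m,k)$ put $n=tk$, $v_n(d)=(\cos\frac{2\pi d}{n},\sin\frac{2\pi d}{n})$, $s_j=jm\bmod k\in\{0,\dots,k-1\}$ for $0\le j\le k-1$. The core of $(m,k)$ is the sequence of unit edges $v_n(s_0),\dots,v_n(s_{k-1})$. Decomposition tree: for $k\ge2$ the Farey parents of $(m,k)$ are $(m_1,k_1),(m_2,k_2)$ with $k_1=m^{-1}\bmod k\in\{1,\dots,k-1\}$, $m_1=(mk_1-1)/k$, $(m_2,k_2)=(m-m_1,k-k_1)$; these are admissible with $m_2k_1-m_1k_2=1$. The decomposition tree has root $(m,k)$; a node with denominator $\ge2$ has its first and second Farey parents as left and right child, and nodes with denominator $1$ are leaves. Fan-twist splicing of cores: for admissible $(m_1,k_1),(m_2,k_2)$ with mediant $(m,k)=(m_1+m_2,k_1+k_2)$ and $n=tk$, rotate core edge $j$ of $(m_1,k_1)$ by $+j\cdot\frac{2\pi}{k_1n}$ ($0\le j\le k_1-1$) and core edge $i$ of $(m_2,k_2)$ by $+\frac{2\pi}{n}-i\cdot\frac{2\pi}{k_2n}$ ($0\le i\le k_2-1$), and list the first block followed by the second. These rotation angles are the fan-twist amounts. For a core run $\mathsf{C}_1\cdots\mathsf{C}_{k-1}$ the first edge of this list (edge $0$ of $(m_1,k_1)$) is omitted. Templates: $\mathsf{C}_j$ denotes the core letter of index $j$ (unit edge of direction $s_j$).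 A decoration token is a unit edge whose direction is a multiple of $k$, i.e. of direction angle $2\pi c/t$ with $c\in\{0,\dots,t-1\}$ (the same $c$ for parents and child); $\mathsf{Z}$ is the token with $c=0$ and $\mathsf{K}$ the token with $c=1$ (direction $k$, angle $2\pi/t$). A template is a boundary word of the shape (finitely many decorations)(contiguous core run, either $\mathsf{C}_0\cdots\mathsf{C}_{k-1}$ or $\mathsf{C}_1\cdots\mathsf{C}_{k-1}$)(finitely many decorations), read as a scheme valid for every $(m,k)$. For a given $(m,k)$ a template determines a path starting at the origin, and a pair $(\ell,u)$ of templates determines a part (the pair of paths of $\ell$ and of $u$). A pair $(\ell,u)$ is closed if, counting $\mathsf{C}_0$ as the letter $\mathsf{Z}$ (both have angle $0$), the sums of the decoration vectors of $\ell$ and of $u$ agree. The seven template pairs (lower word $\ell$; upper word $u$), the boundary words of the original Modulo Krinkle prototile and of the two parts of each of its variants m, p, q: - original: $\mathsf{C}_0\cdots\mathsf{C}_{k-1}\mathsf{K}$; $\mathsf{K}\mathsf{C}_1\cdots\mathsf{C}_{k-1}\mathsf{Z}$. - m, part 1: $\mathsf{C}_0\cdots\mathsf{C}_{k-1}$; $\mathsf{C}_1\cdots\mathsf{C}_{k-1}\mathsf{Z}$. - m, part 2: $\mathsf{C}_1\cdots\mathsf{C}_{k-1}\mathsf{K}$; $\mathsf{K}\mathsf{C}_1\cdots\mathsf{C}_{k-1}$. - p, part 1: $\mathsf{C}_0\cdots\mathsf{C}_{k-1}\mathsf{K}$; $\mathsf{K}\mathsf{Z}\mathsf{C}_1\cdots\mathsf{C}_{k-1}$.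 - p, part 2: $\mathsf{C}_0\cdots\mathsf{C}_{k-1}\mathsf{K}$; $\mathsf{C}_1\cdots\mathsf{C}_{k-1}\mathsf{K}\mathsf{Z}$. - q, part 1: $\mathsf{C}_1\cdots\mathsf{C}_{k-1}\mathsf{Z}\mathsf{K}$; $\mathsf{K}\mathsf{C}_1\cdots\mathsf{C}_{k-1}\mathsf{Z}$. - q, part 2: $\mathsf{Z}\mathsf{K}\mathsf{C}_1\cdots\mathsf{C}_{k-1}$; $\mathsf{K}\mathsf{C}_1\cdots\mathsf{C}_{k-1}\mathsf{Z}$. *)

(* Defs.v *)
From mathcomp Require Import all_boot all_order all_algebra.
From mathcomp Require Import reals trigo.
From mathcomp Require Import zify ring.

Set Implicit Arguments.
Unset Strict Implicit.
Unset Printing Implicit Defensive.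

Import Order.TTheory GRing.Theory Num.Theory.

Local Open Scope ring_scope.

(* The pair (m, k) with denominator k. *)
Definition param := (nat * nat)%type.

(* All admissible parameters have nonnegative entries, so no generality is
   lost by using nat instead of int. *)
Definition admissible (p : param) : bool :=
  [|| (0 < p.1 < p.2)%N && coprime p.1 p.2, p == (0, 1)%N | p == (1, 1)%N].

Definition mediant (p1 p2 : param) : param := (p1.1 + p2.1, p1.2 + p2.2)%N.

(* For 2 <= k the ring 'Z_k is the ring of integers mod k, and its elements
   coerce to their representatives in {0, ..., k - 1}. *)
Definition farey_parent1 (p : param) : param :=
  let: (m, k) := p in
  let k1 := nat_of_ord ((m%:R : 'Z_k)^-1) in
  ((m * k1 - 1) %/ k, k1)%N.

Definition farey_parent2 (p : param) : param :=
  let q := farey_parent1 p in (p.1 - q.1, p.2 - q.2)%N.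

Inductive tree : Type :=
| Leaf of param
| Node of param & tree & tree.

Definition root_label (T : tree) : param :=
  match T with Leaf p => p | Node p _ _ => p end.

(* The recursion is bounded by [fuel]; denominators strictly decrease along
   the tree, so fuel equal to the denominator is enough: see
   [decompositionE]. *)
Fixpoint decomposition_rec (fuel : nat) (p : param) : tree :=
  if fuel is fuel'.+1 then
    if (2 <= p.2)%N then
      Node p (decomposition_rec fuel' (farey_parent1 p))
             (decomposition_rec fuel' (farey_parent2 p))
    else Leaf p
  else Leaf p.

Definition decomposition (p : param) : tree := decomposition_rec p.2 p.

Lemma farey_parentsP (p : param) : admissible p -> (2 <= p.2)%N ->
  let p1 := farey_parent1 p in let p2 := farey_parent2 p in
  [/\ admissible p1 && admissible p2,
      (0 < p1.2 < p.2)%N,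
      (p1.2 * p.1 = 1 %[mod p.2])%N /\ (p1.1 * p.2 = p.1 * p1.2 - 1)%N,
      (p2.1 * p1.2 - p1.1 * p2.2 = 1)%N
    & mediant p1 p2 = p].
Proof.
case: p => m k adm; rewrite [(m, k).2]/= => k2; cbv zeta.
move: adm; rewrite /admissible [(m, k).1]/= => adm.
have {adm} /andP[/andP[m0 mk] cmk] : ((0 < m < k) && coprime m k)%N.
  by case/or3P: adm => // /eqP [_ ke]; move: k2; rewrite ke.
set x : 'Z_k := (m%:R)^-1; set k1 := nat_of_ord x.
have k1k : (k1 < k)%N by apply: leq_trans (ltn_ord x) _; rewrite Zp_cast.
have inv : (k1 * m = 1 %[mod k])%N.
  have mx : (k1 * m)%:R = 1 :> 'Z_k.
    by rewrite natrM natr_Zp mulVr // unitZpE // coprime_sym.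
  have := congr1 (@nat_of_ord _) mx.
  by rewrite -[1]/(1%:R) !val_Zp_nat.
have k10 : (0 < k1)%N.
  by rewrite lt0n; apply/eqP => k10; move: inv; rewrite k10 mul0n mod0n modn_small.
have e : (m * k1 = (m * k1) %/ k * k + 1)%N.
  by rewrite {1}(divn_eq (m * k1) k) (mulnC m) inv (modn_small k2).
set a := ((m * k1) %/ k)%N in e.
have E1 : farey_parent1 (m, k) = (a, k1).
  by rewrite /farey_parent1 -/x -/k1 e addnK mulnK //; lia.
have E2 : farey_parent2 (m, k) = (m - a, k - k1)%N by rewrite /farey_parent2 E1.
rewrite E1 E2 /= {E1 E2}.
have am : (a < m)%N by nia.
have ak1 : (a < k1)%N by nia.
have det : ((m - a) * k1 = a * (k - k1) + 1)%N by nia.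
have c1 : coprime a k1.
  rewrite /coprime -dvdn1 -(dvdn_addr 1%N (_ : gcdn a k1 %| a * (k - k1))%N) ?dvdn_mulr ?dvdn_gcdl //.
  by rewrite -det dvdn_mull // dvdn_gcdr.
have c2 : coprime (m - a) (k - k1).
  rewrite /coprime -dvdn1 -(dvdn_addr 1%N (_ : gcdn (m - a) (k - k1) %| a * (k - k1))%N).
    by rewrite -det dvdn_mulr // dvdn_gcdl.
  by rewrite dvdn_mull // dvdn_gcdr.
have mak : (m - a <= k - k1)%N by nia.
split.
- apply/andP; split.
    rewrite /admissible /= c1 andbT; case: (posnP a) => [a0|a0]; last by rewrite ak1.
    have k11 : k1 = 1%N by nia.
    by rewrite a0 k11.
  rewrite /admissible /= c2 andbT !xpair_eqE.
  move: mak; rewrite leq_eqVlt => /orP[/eqP eq|lt]; last by rewrite subn_gt0 am lt.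
  move: c2; rewrite eq /coprime gcdnn => /eqP ->.
  by rewrite eqxx orbT.
- by rewrite k10 k1k.
- by split => //; rewrite e addnK.
- by rewrite det addKn.
- by rewrite /mediant /=; congr pair; lia.
Qed.

Lemma decompositionE (p : param) : admissible p ->
  decomposition p =
    if (2 <= p.2)%N then
      Node p (decomposition (farey_parent1 p)) (decomposition (farey_parent2 p))
    else Leaf p.
Proof.
have stable : forall f q, admissible q -> (q.2 <= f)%N ->
    decomposition_rec f q = decomposition q.
  rewrite /decomposition => f q.
  have [n] := ubnP q.2; elim: n q f => // n IH q [|f] qn admq qf.
    by move: qf; rewrite leqn0 => /eqP ->.
  case: (posnP q.2) => [q0|q0]; first by rewrite q0 /= q0.
  rewrite -[in RHS](prednK q0) /=.
  case: ifP => // q2.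
  have [/andP[a1 a2] /andP[h1 h2] _ _ _] := farey_parentsP admq q2.
  have h3 : ((farey_parent2 q).2 < q.2)%N by rewrite /=; lia.
  by congr Node; rewrite !IH //; lia.
move=> admp; rewrite {1}/decomposition.
case: (posnP p.2) => [p0|p0]; first by rewrite p0.
rewrite -[in LHS](prednK p0) /=; case: ifP => // p2.
have [/andP[a1 a2] /andP[h1 h2] _ _ _] := farey_parentsP admp p2.
have h3 : ((farey_parent2 p).2 < p.2)%N by rewrite /=; lia.
by congr Node; rewrite !stable //; lia.
Qed.

(* An edge is given by its displacement vector; a path is the sequence of its
   edges, starting at the origin. *)
Definition edge (R : realType) := (R * R)%type.

Definition unit_edge (R : realType) (a : R) : edge R := (cos a, sin a).

(* The unit vector v_n(d). *)
Definition vdir (R : realType) (n d : nat) : edge R :=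
  unit_edge (2 * pi * d%:R / n%:R).

Definition rotate_edge (R : realType) (a : R) (e : edge R) : edge R :=
  (cos a * e.1 - sin a * e.2, sin a * e.1 + cos a * e.2).

Definition vertices (R : realType) (s : seq (edge R)) : seq (edge R) :=
  0 :: scanl +%R 0 s.

Definition endpoint (R : realType) (s : seq (edge R)) : edge R :=
  last 0 (vertices s).

Definition core_direction (p : param) (j : nat) : nat := (j * p.1 %% p.2)%N.

Definition core (R : realType) (t : nat) (p : param) : seq (edge R) :=
  [seq vdir R (t * p.2) (core_direction p j) | j <- iota 0 p.2].

(* [c1] and [c2] are edge sequences of lengths [k1] and [k2]. *)
Definition fan_splice (R : realType) (t k1 k2 : nat) (c1 c2 : seq (edge R)) :
    seq (edge R) :=
  let n := (t * (k1 + k2))%N in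
  [seq rotate_edge (j%:R * (2 * pi / (k1 * n)%:R)) (nth 0 c1 j)
    | j <- iota 0 k1] ++
  [seq rotate_edge (2 * pi / n%:R - i%:R * (2 * pi / (k2 * n)%:R)) (nth 0 c2 i)
    | i <- iota 0 k2].

(* Only the denominators of the labels enter, through the fan-twist amounts. *)
Fixpoint generate (R : realType) (t : nat) (T : tree) : seq (edge R) :=
  match T with
  | Leaf _ => [:: unit_edge 0]
  | Node _ l r => fan_splice t (root_label l).2 (root_label r).2
                    (generate R t l) (generate R t r)
  end.

(* The core run is C_0 ... C_{k-1} if [tpl_full] holds, and C_1 ... C_{k-1}
   otherwise. *)
Record template (t : nat) := Template {
  tpl_pre : seq 'I_t;
  tpl_full : bool;
  tpl_post : seq 'I_t }.

Definition directions (t : nat) (p : param) (T : template t) : seq nat :=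
  [seq (val c * p.2)%N | c <- tpl_pre T] ++
  [seq core_direction p j
    | j <- if tpl_full T then iota 0 p.2 else iota 1 p.2.-1] ++
  [seq (val c * p.2)%N | c <- tpl_post T].

Definition word (R : realType) (t : nat) (p : param) (T : template t) :
    seq (edge R) :=
  [seq vdir R (t * p.2) d | d <- directions p T].

Definition decoration (R : realType) (t c : nat) : edge R := vdir R t c.

(* The edge of a decoration token does not depend on the parameter. *)
Lemma decorationE (R : realType) (t c : nat) (p : param) : (0 < t)%N ->
  admissible p -> vdir R (t * p.2) (c * p.2) = decoration R t c.
Proof.
move=> t0 adm; have k0 : (0 < p.2)%N.
  case: p adm => m k; rewrite /admissible /= => /or3P[|/eqP[_ ->]|/eqP[_ ->]] //.
  by case/andP => /andP[_]; case: k.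
have tn : (t%:R : R) != 0 by rewrite pnatr_eq0 -lt0n.
have kn : (p.2%:R : R) != 0 by rewrite pnatr_eq0 -lt0n.
rewrite /decoration /vdir !natrM; congr unit_edge.
by field; rewrite tn kn.
Qed.

(* Put the core edges [c] and the decorations of [T] in their positions; the
   first edge of [c] is omitted if the core run of [T] starts at C_1. *)
Definition attach (R : realType) (t : nat) (T : template t)
    (c : seq (edge R)) : seq (edge R) :=
  [seq decoration R t (val x) | x <- tpl_pre T] ++
  (if tpl_full T then c else behead c) ++
  [seq decoration R t (val x) | x <- tpl_post T].

Definition spliced_word (R : realType) (t : nat) (p1 p2 : param)
    (T : template t) : seq (edge R) :=
  attach T (fan_splice t p1.2 p2.2 (core R t p1) (core R t p2)).

(* A letter C_0 of the core run is counted as a decoration Z. *)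
Definition decoration_sum (R : realType) (t : nat) (T : template t) : edge R :=
  (if tpl_full T then decoration R t 0 else 0) +
  \sum_(c <- tpl_pre T ++ tpl_post T) decoration R t (val c).

Definition closed_pair (R : realType) (t : nat)
    (P : template t * template t) : Prop :=
  decoration_sum R P.1 = decoration_sum R P.2.

Definition splicing_lifts (R : realType) (t : nat)
    (P : template t * template t) : Prop :=
  forall p1 p2 : param, admissible p1 -> admissible p2 ->
    (p2.1 * p1.2 - p1.1 * p2.2 = 1)%N ->
    let p := mediant p1 p2 in
    [/\ spliced_word R p1 p2 P.1 = word R p P.1
          /\ vertices (spliced_word R p1 p2 P.1) = vertices (word R p P.1),
        spliced_word R p1 p2 P.2 = word R p P.2
          /\ vertices (spliced_word R p1 p2 P.2) = vertices (word R p P.2)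
      & endpoint (word R p P.1) = endpoint (word R p P.2)].

Definition tokZ (t : nat) (ht : (1 < t)%N) : 'I_t := Ordinal (ltnW ht).
Definition tokK (t : nat) (ht : (1 < t)%N) : 'I_t := Ordinal ht.

Inductive part_name : Type := Original | M1 | M2 | P1 | P2 | Q1 | Q2.

(* Lower word, upper word. *)
Definition template_pair (t : nat) (ht : (1 < t)%N) (x : part_name) :
    template t * template t :=
  let Z := tokZ ht in
  let K := tokK ht in
  match x with
  | Original => (Template [::] true [:: K],      Template [:: K] false [:: Z])
  | M1       => (Template [::] true [::],        Template [::] false [:: Z])
  | M2       => (Template [::] false [:: K],     Template [:: K] false [::])
  | P1       => (Template [::] true [:: K],      Template [:: K; Z] false [::])
  | P2       => (Template [::] true [:: K],      Template [::] false [:: K; Z])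
  | Q1       => (Template [::] false [:: Z; K],  Template [:: K] false [:: Z])
  | Q2       => (Template [:: Z; K] false [::],  Template [:: K] false [:: Z])
  end.

Definition only_ZK (t : nat) (ht : (1 < t)%N) (T : template t) : Prop :=
  all [in [:: tokZ ht; tokK ht]] (tpl_pre T ++ tpl_post T).

(* Main.v *)
Require Import Defs.
From mathcomp Require Import all_boot all_order all_algebra.
From mathcomp Require Import reals trigo.
From mathcomp Require Import zify ring.

(** Everything rests on one integer identity.  Let [(m, k)] be the mediant of
    [(m1, k1)] and [(m2, k2)], with [m2 * k1 - m1 * k2 = 1].  Then
    [m * k1 = m1 * k + 1] and [m2 * k = m * k2 + 1], so the slope [m / k] is
    slightly above [m1 / k1] and slightly below [m2 / k2].  Multiplying by an
    index [j < k1] (resp. [i < k2]), the error [j / (k1 * k)] (resp.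
    [i / (k2 * k)]) is too small to change the integer part, so the fractional
    parts satisfy, exactly and with no reduction modulo a full turn,
    [s_j / k = s1_j / k1 + j / (k1 * k)] and
    [s_(k1 + i) / k = s2_i / k2 + 1 / k - i / (k2 * k)]
    ([core_direction_mediant_left] and [core_direction_mediant_right]).
    Multiplied by [2 * pi / t], the correction terms are the fan-twist
    amounts.  Hence splicing two parent cores gives the core of the mediant
    ([fan_splice_core]), and induction on the denominator along the
    decomposition tree generates every core ([generate_core]).

    A decoration has angle [2 * pi * c / t], whatever the parameter; attaching
    the decorations to the core therefore yields the word of the template
    ([attach_core]), and a spliced word is the word of the mediant.  Finally
    the endpoint of a path is the sum of its edges, and in a word this is the
    sum of the decorations, [C_0] included, plus the sum of
    [C_1, ..., C_(k-1)], which is common to both words of a pair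
    ([endpoint_word]): a pair closes up as soon as its decoration sums
    agree. *)

Set Implicit Arguments.
Unset Strict Implicit.
Unset Printing Implicit Defensive.

Import Order.TTheory GRing.Theory Num.Theory.

Local Open Scope ring_scope.

(** * Admissible parameters *)

Lemma admissible_denom_gt0 (p : param) : admissible p -> (0 < p.2)%N.
Proof.
case: p => m k; rewrite /admissible /= => /or3P[|/eqP[_ ->]|/eqP[_ ->]] //.
by case/andP=> /andP[_]; case: k.
Qed.

Lemma admissible_le (p : param) : admissible p -> (p.1 <= p.2)%N.
Proof.
case: p => m k; rewrite /admissible /= => /or3P[|/eqP[-> ->]|/eqP[-> ->]] //.
by case/andP=> /andP[_ /ltnW].
Qed.

(** The determinant condition writes [1] as an integer combination of the
    entries of the mediant, which are therefore coprime; it also excludes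
    that both parents have slope [1]. *)
Lemma mediant_admissible (p1 p2 : param) :
    admissible p1 -> admissible p2 -> (p2.1 * p1.2 - p1.1 * p2.2 = 1)%N ->
  admissible (mediant p1 p2).
Proof.
move=> a1 a2.
move: (admissible_denom_gt0 a1) (admissible_denom_gt0 a2).
move: (admissible_le a1) (admissible_le a2) => {a1 a2}.
case: p1 p2 => m1 k1 [m2 k2]; rewrite /mediant /admissible /=.
move=> le1 le2 k1_gt0 k2_gt0 det; apply/or3P/Or31/andP; split; first by nia.
rewrite /coprime -dvdn1; set g := gcdn _ _.
have e : ((m1 + m2) * k1 = m1 * (k1 + k2) + 1)%N by lia.
have gm : (g %| m1 * (k1 + k2))%N by rewrite dvdn_mull // dvdn_gcdr.
by rewrite -(dvdn_addr 1 gm) -e dvdn_mulr // dvdn_gcdl.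
Qed.

(** * Directions of the core of a mediant *)

(** Used with [b = k] and [s] a residue: it bounds the corrected direction
    below [k], so that no reduction modulo [k] is left to perform. *)
Lemma ltn_mulnD (a b s j : nat) :
  (s < a -> j < b -> b * s + j < a * b)%N.
Proof.
move=> lts ltj; apply: (@leq_trans (b * s.+1)); last first.
  by rewrite mulnC leq_mul2r lts orbT.
by rewrite mulnS addnC ltn_add2r.
Qed.

(** Since [m * k1 = m1 * k + 1], the number [r = (k * s1_j + j) / k1] is the
    integer [j * m - k * (j * m1 %/ k1)]; the bounds on [s1_j] and [j] give
    [r < k], so that [r] is the residue of [j * m] itself. *)
Lemma core_direction_mediant_left (p1 p2 : param) (j : nat) :
    (p2.1 * p1.2 - p1.1 * p2.2 = 1)%N -> (j < p1.2)%N ->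
  (p1.2 * core_direction (mediant p1 p2) j
   = (p1.2 + p2.2) * core_direction p1 j + j)%N.
Proof.
case: p1 p2 => m1 k1 [m2 k2]; rewrite /core_direction /mediant /=.
move=> det ltj; have k1_gt0 : (0 < k1)%N by lia.
have := divn_eq (j * m1) k1; have := ltn_pmod (j * m1) k1_gt0.
set s := (_ %% k1)%N; set q := (_ %/ k1)%N => lts eq_s.
have e : ((m1 + m2) * k1 = m1 * (k1 + k2) + 1)%N by lia.
have er : (k1 * (j * (m1 + m2)) = k1 * (q * (k1 + k2)) + ((k1 + k2) * s + j))%N.
  rewrite mulnCA (mulnC k1) e mulnDr (mulnA j) eq_s; lia.
pose r := (j * (m1 + m2) - q * (k1 + k2))%N.
have r_eq : (k1 * r = (k1 + k2) * s + j)%N by rewrite mulnBr er addKn.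
have ltr : (r < k1 + k2)%N.
  by rewrite -(ltn_pmul2l k1_gt0) r_eq ltn_mulnD // ltn_addr.
have -> : (j * (m1 + m2) = q * (k1 + k2) + r)%N.
  by rewrite subnKC // -(leq_pmul2l k1_gt0) er leq_addr.
by rewrite modnMDl modn_small.
Qed.

(** Here [m2 * k = m * k2 + 1] makes the correction negative, and the extra
    [k2], which is one unit of direction, comes from
    [k1 * m = m1 * k + 1]. *)
Lemma core_direction_mediant_right (p1 p2 : param) (i : nat) :
    (0 < p1.2)%N -> (p2.1 * p1.2 - p1.1 * p2.2 = 1)%N -> (i < p2.2)%N ->
  (p2.2 * core_direction (mediant p1 p2) (p1.2 + i) + i
   = (p1.2 + p2.2) * core_direction p2 i + p2.2)%N.
Proof.
case: p1 p2 => m1 k1 [m2 k2]; rewrite /core_direction /mediant /=.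
move=> k1_gt0 det lti; have k2_gt0 : (0 < k2)%N by lia.
have := divn_eq (i * m2) k2; have := ltn_pmod (i * m2) k2_gt0.
set s := (_ %% k2)%N; set q := (_ %/ k2)%N => lts eq_s.
have e1 : ((m1 + m2) * k1 = m1 * (k1 + k2) + 1)%N by lia.
have e2 : (m2 * (k1 + k2) = (m1 + m2) * k2 + 1)%N by lia.
have er : (k2 * (i * (m1 + m2) + 1) + i
           = k2 * (q * (k1 + k2)) + ((k1 + k2) * s + k2))%N.
  have -> : (k2 * (i * (m1 + m2) + 1) + i
             = i * ((m1 + m2) * k2 + 1) + k2)%N by lia.
  by rewrite -e2 mulnA eq_s; lia.
have le : (q * (k1 + k2) <= i * (m1 + m2) + 1)%N.
  rewrite -(leq_pmul2l k2_gt0) -(leq_add2r i) er leq_add2l.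
  by rewrite (leq_trans (ltnW lti)) // leq_addl.
pose r := (i * (m1 + m2) + 1 - q * (k1 + k2))%N.
have r_def : (i * (m1 + m2) + 1 = q * (k1 + k2) + r)%N by rewrite subnKC.
have r_eq : (k2 * r + i = (k1 + k2) * s + k2)%N.
  by move: er; rewrite r_def mulnDr -addnA => /addnI.
have ltr : (r < k1 + k2)%N.
  rewrite -(ltn_pmul2l k2_gt0) (leq_ltn_trans (leq_addr i _)) // r_eq.
  by rewrite ltn_mulnD // -{1}[k2]add0n ltn_add2r.
have -> : ((k1 + i) * (m1 + m2) = (m1 + q) * (k1 + k2) + r)%N.
  by rewrite mulnDl (mulnC k1) e1; lia.
by rewrite modnMDl (modn_small ltr).
Qed.

(** * Fan-twist splicing of cores *)

Lemma rotate_unit_edge (R : realType) (a b : R) :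
  rotate_edge a (unit_edge b) = unit_edge (a + b).
Proof. by rewrite /rotate_edge /unit_edge /= cosD sinD. Qed.

(** The angles themselves agree, not only modulo [2 * pi]: dividing the two
    identities on directions by [k1] (resp. [k2]) and scaling by
    [2 * pi / (t * k)] turns the correction terms into the fan-twist
    amounts. *)
Lemma fan_splice_core (R : realType) (t : nat) (p1 p2 : param) :
    (0 < t)%N -> (0 < p1.2)%N -> (0 < p2.2)%N ->
    (p2.1 * p1.2 - p1.1 * p2.2 = 1)%N ->
  fan_splice t p1.2 p2.2 (core R t p1) (core R t p2)
  = core R t (mediant p1 p2).
Proof.
move=> t_gt0 k1_gt0 k2_gt0 det.
have t0 : (t%:R : R) != 0 by rewrite pnatr_eq0 -lt0n.
have k10 : (p1.2%:R : R) != 0 by rewrite pnatr_eq0 -lt0n.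
have k20 : (p2.2%:R : R) != 0 by rewrite pnatr_eq0 -lt0n.
have k0 : (p1.2%:R + p2.2%:R : R) != 0.
  by rewrite -natrD pnatr_eq0 -lt0n addn_gt0 k1_gt0.
rewrite /fan_splice {3}/core [(mediant p1 p2).2]/= iotaD map_cat.
rewrite add0n.
have -> : iota p1.2 p2.2 = [seq (p1.2 + i)%N | i <- iota 0 p2.2].
  by rewrite -iotaDl addn0.
rewrite -map_comp.
congr (_ ++ _); apply/eq_in_map => j; rewrite mem_iota add0n => /andP[_ ltj].
  rewrite (nth_map 0%N) ?size_iota // nth_iota // add0n /vdir.
  rewrite rotate_unit_edge; congr unit_edge.
  have := congr1 (fun x => x%:R : R) (core_direction_mediant_left det ltj).
  rewrite !(natrM, natrD) => e.
  (* The product k1 * s_j is isolated so that the identity in e applies. *)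
  apply: (mulfI k10).
  rewrite [RHS](_ : _ = 2 * pi *
    (p1.2%:R * (core_direction (mediant p1 p2) j)%:R)
      / (t%:R * (p1.2%:R + p2.2%:R))); last by field; rewrite t0 k0.
  by rewrite e; field; rewrite t0 k0 k10.
rewrite (nth_map 0%N) ?size_iota // nth_iota // add0n /vdir /=.
rewrite rotate_unit_edge; congr unit_edge.
have := core_direction_mediant_right k1_gt0 det ltj.
move=> /(congr1 (fun x => x%:R : R)); rewrite !(natrM, natrD).
move=> /(canRL (addrK _)) e.
apply: (mulfI k20).
rewrite [RHS](_ : _ = 2 * pi *
  (p2.2%:R * (core_direction (mediant p1 p2) (p1.2 + j))%:R)
    / (t%:R * (p1.2%:R + p2.2%:R))); last by field; rewrite t0 k0.
by rewrite e; field; rewrite t0 k0 k20.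
Qed.

Lemma root_label_decomposition (p : param) :
  root_label (decomposition p) = p.
Proof. by rewrite /decomposition; case: p.2 => //= n; case: ifP. Qed.

Lemma generate_core (R : realType) (t : nat) (p : param) :
  (0 < t)%N -> admissible p -> generate R t (decomposition p) = core R t p.
Proof.
move=> t_gt0; have [n] := ubnP p.2; elim: n p => // n IH p ltpn adm.
rewrite decompositionE //; case: ifP => [p2|/negbT].
  have [/andP[a1 a2] /andP[k1_gt0 ltk] _ det med] := farey_parentsP adm p2.
  have k2_gt0 := admissible_denom_gt0 a2.
  have k_eq : ((farey_parent1 p).2 + (farey_parent2 p).2 = p.2)%N.
    by rewrite -[in RHS]med.
  rewrite [LHS]/= !root_label_decomposition !IH //; try lia.
  by rewrite fan_splice_core // med.
rewrite -ltnNge ltnS => le1; have k1 : p.2 = 1%N.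
  by apply/eqP; rewrite eqn_leq le1 admissible_denom_gt0.
by rewrite /= /core k1 /= /vdir /core_direction k1 modn1 mulr0 mul0r.
Qed.

(** * Words of templates *)

Lemma attach_core (R : realType) (t : nat) (p : param) (T : template t) :
  (0 < t)%N -> admissible p -> attach T (core R t p) = word R p T.
Proof.
move=> t_gt0 adm; rewrite /attach /word /directions !map_cat -!map_comp.
congr (_ ++ (_ ++ _)); try by apply: eq_map => c; rewrite /= decorationE.
case: (tpl_full T) => //.
by rewrite /core; have := admissible_denom_gt0 adm; case: p.2.
Qed.

Lemma spliced_word_mediant (R : realType) (t : nat) (p1 p2 : param)
    (T : template t) :
    (0 < t)%N -> admissible p1 -> admissible p2 ->
    (p2.1 * p1.2 - p1.1 * p2.2 = 1)%N ->
  spliced_word R p1 p2 T = word R (mediant p1 p2) T.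
Proof.
move=> t_gt0 a1 a2 det.
rewrite /spliced_word fan_splice_core ?admissible_denom_gt0 //.
exact: attach_core t_gt0 (mediant_admissible a1 a2 det).
Qed.

(** * Closedness *)

Lemma endpointE (R : realType) (s : seq (edge R)) :
  endpoint s = \sum_(e <- s) e.
Proof.
suff last_partial_sum x : last x (scanl +%R x s) = x + \sum_(e <- s) e.
  by rewrite /endpoint /vertices /= last_partial_sum add0r.
elim: s x => [|e s IH] x /=; first by rewrite big_nil addr0.
by rewrite IH big_cons addrA.
Qed.

(** [C_0] has angle [0], like the decoration [Z]: a core run starting at
    [C_0] contributes that decoration and the same [C_1, ..., C_(k-1)] as a
    run starting at [C_1]. *)
Lemma endpoint_word (R : realType) (t : nat) (p : param) (T : template t) :
    (0 < t)%N -> admissible p ->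
  endpoint (word R p T) = decoration_sum R T
    + \sum_(j <- iota 1 p.2.-1) vdir R (t * p.2) (core_direction p j).
Proof.
move=> t_gt0 adm; rewrite -attach_core // endpointE /attach /decoration_sum.
rewrite !big_cat /= !big_map.
set a := \sum_(c <- tpl_pre T) _; set b := \sum_(c <- tpl_post T) _.
set s := \sum_(j <- iota 1 _) _.
have -> : \sum_(e <- if tpl_full T then core R t p else behead (core R t p)) e
    = (if tpl_full T then decoration R t 0 else 0) + s.
  have := admissible_denom_gt0 adm; rewrite /s /core; case: p.2 => // k _.
  case: (tpl_full T); rewrite /= ?big_cons big_map ?add0r //.
  by rewrite /decoration /vdir /core_direction mod0n !mulr0 !mul0r.
by rewrite -(addrA _ s) addrCA (addrC s) !addrA.
Qed.

(** The condition on [P] does not mention the parameter, and the part of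
    [endpoint_word] that does is the same for both words. *)
Lemma closed_pair_splicing_lifts (R : realType) (t : nat)
    (P : template t * template t) :
  (0 < t)%N -> closed_pair R P -> splicing_lifts R P.
Proof.
move=> t_gt0 cl p1 p2 a1 a2 det /=; have adm := mediant_admissible a1 a2 det.
by rewrite !spliced_word_mediant // !endpoint_word // cl.
Qed.

(** * The seven template pairs *)

Lemma template_pair_closed (R : realType) (t : nat) (ht : (1 < t)%N)
    (x : part_name) : closed_pair R (template_pair ht x).
Proof.
by case: x; rewrite /closed_pair /decoration_sum /= ?(big_cons, big_nil) /=
     ?(addr0, add0r) // addrC.
Qed.

(** The direction of [C_0] is [0], that of [Z]; apart from the common run
    [C_1, ..., C_(k-1)], both words of a pair carry the same letters. *)
Lemma template_pair_directions (t : nat) (ht : (1 < t)%N) (x : part_name)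
    (p : param) : admissible p ->
  perm_eq (directions p (template_pair ht x).1)
          (directions p (template_pair ht x).2).
Proof.
move=> /admissible_denom_gt0 k_gt0.
have e0 : iota 0 p.2 = 0%N :: iota 1 p.2.-1 by case: p.2 k_gt0.
have c0 : core_direction p 0 = 0%N by rewrite /core_direction mod0n.
case: x; apply/permP => a;
  rewrite /directions /= ?e0 /= ?c0 ?mul0n ?mul1n ?count_cat /= ?count_cat /=;
  lia.
Qed.

Theorem theorem6p1 (R : realType) (t : nat) (ht : (1 < t)%N) :
  (forall p : param, admissible p ->
     generate R t (decomposition p) = core R t p)
  /\
  ((forall P : template t * template t,
      closed_pair R P -> splicing_lifts R P)
   /\
   (forall x : part_name,
      let P := template_pair ht x in
      [/\ closed_pair R P,
          only_ZK ht P.1 /\ only_ZK ht P.2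
        & forall p : param, admissible p ->
            perm_eq (directions p P.1) (directions p P.2)]))
  /\
  ((forall x : part_name,
      let P := template_pair ht x in
      (forall p : param, admissible p ->
         let c := generate R t (decomposition p) in
         [/\ attach P.1 c = word R p P.1
               /\ vertices (attach P.1 c) = vertices (word R p P.1)
           & attach P.2 c = word R p P.2
               /\ vertices (attach P.2 c) = vertices (word R p P.2)])
      /\ splicing_lifts R P)
   /\
   (tpl_pre (template_pair ht Original).1 ++
      tpl_post (template_pair ht Original).1 = [:: tokK ht]
    /\
    forall p : param, admissible p ->
      let w := word R p (template_pair ht Original).1 in
      w = rcons (core R t p) (decoration R t 1)
      /\ w = rcons (generate R t (decomposition p)) (decoration R t 1))).
Proof.
have t_gt0 : (0 < t)%N := ltnW ht.
split; first by move=> p; apply: generate_core.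
split; [split|split].
- by move=> P; apply: closed_pair_splicing_lifts.
- move=> x /=; split; first exact: template_pair_closed.
    by case: x; rewrite /only_ZK /= ?inE ?eqxx ?orbT.
  by move=> p; apply: template_pair_directions.
- move=> x /=; split=> [p adm|].
    by rewrite generate_core // !attach_core.
  exact: closed_pair_splicing_lifts t_gt0 (template_pair_closed R ht x).
- split=> // p adm /=; rewrite generate_core //.
  by rewrite -attach_core // /attach /= cats1.
Qed.
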